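(* Let $\Gamma$ be a finitely generated group and let $X$ be a finite generating set of $\Gamma$. Then for every positive integer $n$, $$\log(\mathrm{w}_{\Gamma,X}(n))\le \mathrm{s}_\Gamma(\mathrm{F}_{\Gamma,X}(2n))\,\log(\mathrm{F}_{\Gamma,X}(2n)).$$
   Context: $\|\cdot\|_X$ denotes word length with respect to $X$. $\mathrm{w}_{\Gamma,X}(n)=|\{\gamma\in\Gamma : \|\gamma\|_X\le n\}|$. $\mathrm{s}_\Gamma(n)$ is the number of normal subgroups $\Delta\lhd\Gamma$ with $[\Gamma:\Delta]\le n$. $\mathrm{F}_{\Gamma,X}(n)$ is the smallest positive integer $N$ such that for every nontrivial $\gamma\in\Gamma$ with $\|\gamma\|_X\le n$ there is a normal subgroup of $\Gamma$ of finite index at most $N$ not containing $\gamma$ (and $\mathrm{F}_{\Gamma,X}(n)=\infty$ if there is no such integer). When $\mathrm{F}_{\Gamma,X}(2n)=\infty$ the right-hand side is interpreted as $\infty$. *)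

(* Defs.v *)
From HB Require Import structures.
From mathcomp Require Import all_boot all_order all_algebra.
From mathcomp Require Import all_classical all_reals all_analysis.

Set Implicit Arguments.
Unset Strict Implicit.
Unset Printing Implicit Defensive.

Local Open Scope classical_set_scope.

(* The minimum of a set of natural numbers; [None] (read: infinity) when the
   set is empty. *)
Definition least (P : set nat) : option nat :=
  if pselect (exists n, `[< P n >]) is left h then Some (ex_minn h) else None.

Section Groups.
Variable G : groupType.
Implicit Types (X H D : set G) (g : G) (n N : nat).

Definition is_subgroup H : Prop := group_closed (mem H).

Definition is_normal_subgroup D : Prop :=
  is_subgroup D /\ forall d g, D d -> D (d ^ g)%g.

Definition generates X : Prop := smallest is_subgroup X = setT.

Definition left_coset g H : set G := [set (g * h)%g | h in H].

Definition left_cosets H : set (set G) := [set left_coset g H | g in setT].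

(* [G : H] <= n; since n is finite, this includes that the index is finite. *)
Definition index_le H n : Prop := (left_cosets H #<= `I_n)%card.

Definition is_word X (s : seq G) : Prop :=
  forall x, x \in s -> X x \/ X (x^-1)%g.

(* [None] exactly when [g] is outside the subgroup generated by [X]. *)
Definition word_length X g : option nat :=
  least [set l | exists s : seq G,
    [/\ is_word X s, size s = l & (\prod_(x <- s) x)%g = g]].

Definition word_length_le X g n : Prop :=
  if word_length X g is Some l then (l <= n)%N else False.

(* Cardinalities are taken with [counting], whose value is +oo on infinite
   sets. *)
Definition word_growth (R : realType) X n : \bar R :=
  counting [set g | word_length_le X g n].

Definition normal_growth (R : realType) N : \bar R :=
  counting [set D | is_normal_subgroup D /\ index_le D N].

Definition residual_finiteness_growth X n : option nat :=
  least [set N | (0 < N)%N /\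
    forall g, g <> 1%g -> word_length_le X g n ->
      exists D, [/\ is_normal_subgroup D, index_le D N & ~ D g]].

End Groups.

Arguments normal_growth G R N : clear implicits.
Arguments word_growth {G} R X n.

(* Main.v *)
Require Import Defs.
From HB Require Import structures.
From mathcomp Require Import all_boot all_order all_algebra.
From mathcomp Require Import all_classical all_reals all_analysis.
From mathcomp Require Import finmap.

(** Distinct [g], [h] in the ball of radius [n] differ by a nontrivial element
  of length at most [2 * n], which some normal subgroup of index at most
  [N := F(2n)] misses. Hence the ball embeds into the product of the quotients
  by the normal subgroups of index at most [N], a set with at most
  [N ^ s(N)] elements. *)

Import Order.TTheory GRing.Theory Num.Theory.

Local Open Scope classical_set_scope.

Lemma leastP (P : set nat) (n : nat) :
  least P = Some n -> P n /\ forall m, P m -> (n <= m)%N.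
Proof.
rewrite /least; case: pselect => // exP [<-].
by case: ex_minnP => m /asboolP Pm min_m; split=> // k /asboolP /min_m.
Qed.

Lemma least_ex (P : set nat) (n : nat) : P n -> exists m, least P = Some m.
Proof.
move=> Pn; rewrite /least; case: pselect => [exP|[]]; first by exists (ex_minn exP).
by exists n; apply/asboolP.
Qed.

Lemma card_le_fin {T : Type} (F : finType) (A : set T) (f : T -> F) :
  (forall x y, A x -> A y -> f x = f y -> x = y) -> (A #<= `I_#|F|)%card.
Proof.
move=> f_inj; pose r x : nat := enum_rank (f x).
have r_inj : {in A &, injective r}.
  by move=> x y /set_mem Ax /set_mem Ay /val_inj /enum_rank_inj /f_inj; apply.
rewrite -(card_le_eql (inj_card_eq r_inj)).
by apply: subset_card_le => _ [x _ <-]; exact: ltn_ord.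
Qed.

Section WordLength.
Context {G : groupType} (X : set G).
Implicit Types (g h : G) (n m : nat).

(** A word of length at most [n] bounds the minimum from above, and conversely the minimum is
    attained. Products and inverses can then be handled by explicit words, without mentioning
    [least]. *)
Lemma word_length_leP g n :
  word_length_le X g n <->
  exists s : seq G,
    [/\ is_word X s, (size s <= n)%N & (\prod_(x <- s) x)%g = g].
Proof.
rewrite /word_length_le; split=> [|[s [Xs s_le_n prod_s]]].
  case E: (word_length X g) => [l|//] l_le_n.
  by have [[s [Xs size_s <-]] _] := leastP _ _ E; exists s; rewrite size_s.
pose L := [set l | exists s' : seq G,
  [/\ is_word X s', size s' = l & (\prod_(x <- s') x)%g = g]].
have Ls : L (size s) by exists s.
have [m E] := least_ex L _ Ls; have [_ min_m] := leastP _ _ E.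
by rewrite /word_length E (leq_trans (min_m _ Ls)).
Qed.

Lemma word_length_leM g h m n :
  word_length_le X g m -> word_length_le X h n ->
  word_length_le X (g * h)%g (m + n).
Proof.
move=> /word_length_leP [s [Xs sm <-]] /word_length_leP [t [Xt tn <-]].
apply/word_length_leP; exists (s ++ t); rewrite size_cat leq_add // big_cat.
by split=> // x; rewrite mem_cat => /orP [/Xs|/Xt].
Qed.

Lemma word_length_leV g n : word_length_le X g n -> word_length_le X g^-1%g n.
Proof.
move=> /word_length_leP [s [Xs sn <-]]; apply/word_length_leP.
exists (rev [seq x^-1%g | x <- s]); rewrite size_rev size_map; split=> //.
  by move=> x; rewrite mem_rev => /mapP [y /Xs Xy ->]; rewrite invgK;
    case: Xy; [right|left].
elim: s {Xs sn} => [|x s IHs]; first by rewrite !big_nil invg1.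
by rewrite /= rev_cons -cats1 big_cat big_seq1 IHs big_cons invgM.
Qed.

End WordLength.

Section Cosets.
Context {G : groupType} (H : set G).
Hypothesis subH : is_subgroup H.

Lemma left_coset_eq (g h : G) :
  left_coset g H = left_coset h H -> H (g^-1 * h)%g.
Proof.
have [/set_mem H1 _] := subH.
move=> eq_gh; have : left_coset h H h by exists 1%g; rewrite ?mulg1.
by rewrite -eq_gh => -[k Hk <-]; rewrite mulKg.
Qed.

(** Numbering the left cosets colours [G] with finitely many colours, and elements of equal colour
    share a coset. These colourings stand in for the quotient maps. *)
Lemma index_le_separate (n : nat) :
  index_le H n.+1 -> exists c : G -> 'I_n.+1,
    forall g h, c g = c h -> H (g^-1 * h)%g.
Proof.
move=> /pcard_leP [f].
have f_lt g : (f (left_coset g H) < n.+1)%N by apply: (@funS _ _ _ _ f); exists g.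
exists (fun g => Ordinal (f_lt g)) => g h [eq_f]; apply: left_coset_eq.
by apply: (@inj _ _ _ f) eq_f; apply/mem_set; [exists g|exists h].
Qed.

(** With a single colour, [1] and any [g] have the same one. This settles the degenerate bound
    [N = 1], where [ln N] vanishes. *)
Lemma index_le1 : index_le H 1 -> H = setT.
Proof.
move=> /index_le_separate [c sep]; apply/seteqP; split=> // g _.
by rewrite -[g]mul1g -invg1; apply: sep; rewrite !ord1.
Qed.

End Cosets.

(** Recording the colour of [g] for every [D] in [S] gives a function from [S] to [n] colours. Two
    distinct elements of [A] get different functions, because some [D] separates them. *)
Lemma separated_card_le {G : groupType} (A : set G) (S : set (set G)) (n : nat) :
  (0 < n)%N -> finite_set S ->
  (forall D, S D -> is_subgroup D /\ index_le D n) ->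
  (forall g h, A g -> A h -> g <> h -> exists2 D, S D & ~ D (g^-1 * h)%g) ->
  (A #<= `I_(n ^ #|` fset_set S|))%card.
Proof.
case: n => // n _ finS S_sub sepA.
have /fin_all_exists [c cP] (D : fset_set S) :
    exists c : G -> 'I_n.+1, forall g h, c g = c h -> val D (g^-1 * h)%g.
  have /S_sub [subD /(index_le_separate _ subD)] // : S (val D).
  by have := valP D; rewrite in_fset_set // => /set_mem.
have -> : (n.+1 ^ #|` fset_set S| = #|{ffun fset_set S -> 'I_n.+1}|)%N.
  by rewrite card_ffun card_ord cardfE.
apply: (card_le_fin _ _ (fun g => [ffun D => c D g])) => g h Ag Ah /ffunP eq_c.
apply: contrapT => /(sepA _ _ Ag Ah) [D SD]; apply.
have SD' : D \in fset_set S by rewrite in_fset_set // mem_set.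
by apply: (cP [` SD']%fset); have := eq_c [` SD']%fset; rewrite !ffunE.
Qed.

Lemma lne_counting_le (R : realType) (T : choiceType) (A : set T) (n k : nat) :
  (0 < n)%N -> (A #<= `I_(n ^ k))%card ->
  (lne (counting A : \bar R) <= k%:R%:E * (ln n%:R)%:E)%E.
Proof.
move=> n_gt0 A_le; rewrite /counting asboolT; last exact: card_le_finite A_le _.
(* The value of [lne] at 0 is [-oo], so an empty [A] is settled apart; otherwise [ln] is monotone on
   the positive reals. *)
rewrite -EFinM mulr_natl -lnXn ?ltr0n // -natrX /=; case: ifP => [_|]; first exact: leNye.
move=> /negbT; rewrite -ltNge => A_gt0.
rewrite lee_fin ler_ln ?posrE // ?ltr0n ?expn_gt0 ?n_gt0 //.
by rewrite ler_nat geq_card_fset_set.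
Qed.

Theorem mainTheorem5 (R : realType) (G : groupType) (X : set G)
    (finX : finite_set X) (genX : generates X) (n : nat) (n_gt0 : (0 < n)%N) :
  (lne (word_growth R X n) <=
   if residual_finiteness_growth X (2 * n)%N is Some N
   then normal_growth G R N * (ln N%:R)%:E
   else +oo)%E.
Proof.
case E: (residual_finiteness_growth X (2 * n)) => [N|]; last exact: leey.
have [[N_gt0 sep2n] _] := leastP _ _ E.
set S := [set D : set G | is_normal_subgroup D /\ index_le D N].
have sep : forall g h, word_length_le X g n -> word_length_le X h n -> g <> h ->
    exists2 D, S D & ~ D (g^-1 * h)%g.
  move=> g h gn hn neq_gh; have [||D [nD iD notD]] := sep2n (g^-1 * h)%g.
  - by move=> /(congr1 (fun x => g * x)%g); rewrite mulVKg mulg1 => /esym.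
  - by rewrite mul2n -addnn; apply: word_length_leM => //; apply: word_length_leV.
  - by exists D.
(* For finite [S] the embedding bounds the ball by [N ^ #|S|]; for infinite [S] the factor
   [counting S] is [+oo]. *)
have [finS|infS] := pselect (finite_set S).
  rewrite /normal_growth -/S /counting asboolT //; apply: lne_counting_le => //.
  by apply: separated_card_le => // D [[]].
rewrite /normal_growth -/S /counting asboolF //.
(* An infinite count makes the right-hand side [+oo], except that
   [+oo * ln 1 = 0]; but for [N = 1] the only candidate subgroup is [G]. *)
have [N1|N_neq1] := eqVneq N 1%N.
  case: infS; apply: (sub_finite_set _ (finite_set1 [set: G])) => D [[subD _]].
  by rewrite N1 => /(index_le1 _ subD).
by rewrite gt0_mulye ?leey // lte_fin ln_gt0 // ltr1n ltn_neqAle eq_sym N_neq1.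
Qed.
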